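(* Let $F$ be a field of characteristic two and let $(A,\sigma)$ be a totally decomposable central simple $F$-algebra with orthogonal involution. Then $$D(A,\sigma)=D(\mathfrak{Pf}(A,\sigma))=\{x^2\mid 0\neq x\in S\},$$ where $S$ is any inseparable subalgebra of $(A,\sigma)$.
   Context: Involutions are of the first kind. $(A,\sigma)$ is totally decomposable if $(A,\sigma)\simeq\bigotimes_{i=1}^n(Q_i,\sigma_i)$ with $(Q_i,\sigma_i)$ quaternion $F$-algebras with involution (each $\sigma_i$ then orthogonal). $\mathrm{Alt}(A,\sigma)=\{\sigma(x)-x\mid x\in A\}$, $\mathrm{Sym}(A,\sigma)=\{x\mid\sigma(x)=x\}$, $\mathrm{Sym}(A,\sigma)^+=\{x\in\mathrm{Sym}(A,\sigma)\mid x^2\in F\}$. For $\alpha\in F$, $\sigma$ represents $\alpha$ if there is a nonzero $x\in A$ with $\sigma(x)x+\alpha\in\mathrm{Alt}(A,\sigma)$; $D(A,\sigma)$ is the set of elements of $F$ represented by $\sigma$. For a symmetric bilinear space $(V,\mathfrak b)$, $D(\mathfrak b)=\{\mathfrak b(v,v)\mid 0\ne v\in V\}$. The bilinear Pfister form $\langle\!\langle \alpha_1,\dots,\alpha_n\rangle\!\rangle$ is $\langle1,\alpha_1\rangle\otimes\cdots\otimes\langle1,\alpha_n\rangle$. The Pfister invariant $\mathfrak{Pf}(A,\sigma)$ is $\langle\!\langle\alpha_1,\dots,\alpha_n\rangle\!\rangle$ where $\alpha_i\in F^\times$ represents the discriminant class $\mathrm{disc}\,\sigma_i\in F^\times/F^{\times2}$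 for a decomposition $\bigotimes(Q_i,\sigma_i)$; its isometry class is independent of the decomposition. If $\deg_FA=2^n$, an inseparable subalgebra is a $2^n$-dimensional subalgebra $S\subseteq\mathrm{Sym}(A,\sigma)^+$ with $C_A(S)=S$, generated as an $F$-algebra by $n$ elements. *)

(* Defs.v *)
From HB Require Import structures.
From mathcomp Require Import all_boot all_order all_algebra all_field.
Set Implicit Arguments. Unset Strict Implicit. Unset Printing Implicit Defensive.
Import GRing.Theory.
Local Open Scope ring_scope.

Section Defs.
Variables (F : fieldType) (A : falgType F).

Definition is_involution (s : A -> A) : Prop :=
  [/\ forall (a : F) (x y : A), s (a *: x + y) = a *: s x + s y,
      forall x y : A, s (x * y) = s y * s x,
      s 1 = 1 &
      forall x : A, s (s x) = x].

Definition Alt (s : A -> A) (z : A) : Prop := exists x : A, z = s x - x.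

Definition Alt_in (Q : {vspace A}) (s : A -> A) (z : A) : Prop :=
  exists2 x : A, x \in Q & z = s x - x.

Definition Sym_plus (s : A -> A) (z : A) : Prop :=
  s z = z /\ exists c : F, z * z = c%:A.

Definition represents (s : A -> A) (alpha : F) : Prop :=
  exists2 x : A, x != 0 & Alt s (s x * x + alpha%:A).

Definition central_simple_sub (Q : {aspace A}) : Prop :=
  ('Z(Q) = 1)%VS /\
  forall I : {vspace A}, (I <= Q)%VS -> (Q * I <= I)%VS -> (I * Q <= I)%VS ->
    I = 0%VS \/ I = Q :> {vspace A}.

Definition central_simple : Prop := central_simple_sub {:A}%AS.

(* orthogonal (char 2 criterion, Knus et al. 2.6): not symplectic, i.e. 1 not in Alt *)
Definition orth_involution (s : A -> A) : Prop := ~ Alt s 1.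

Definition quaternion_sub (Q : {aspace A}) : Prop :=
  central_simple_sub Q /\ \dim Q = 4%N.

(* (A,s) = (Q_0,s_0) (x) ... (x) (Q_{n-1},s_{n-1}) internally:
   s-stable quaternion subalgebras, pairwise commuting, whose product is A,
   with dim A = 4^n (so the multiplication map from the tensor product is an
   isomorphism, compatible with the involutions). *)
Definition tot_decomposition (s : A -> A) (n : nat) (Q : 'I_n -> {aspace A}) : Prop :=
  [/\ forall i, quaternion_sub (Q i),
      forall i (x : A), x \in Q i -> s x \in Q i,
      forall i j, i != j -> (Q i <= 'C(Q j))%VS,
      (\big[@prodv F A/1%VS]_(i < n) (Q i : {vspace A}))%VS = fullv &
      \dim {:A} = (4 ^ n)%N].

(* alpha in F^x represents disc(s|Q): disc s|Q = -Nrd(u) = u^2 (char 2) for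
   nonzero u in Alt(Q, s|Q) *)
Definition represents_disc (Q : {aspace A}) (s : A -> A) (alpha : F) : Prop :=
  alpha != 0 /\ exists2 u : A, (Alt_in Q s u /\ u != 0) & u * u = alpha%:A.

(* inseparable subalgebra, deg A = 2^n *)
Definition inseparable_sub (s : A -> A) (n : nat) (S : {aspace A}) : Prop :=
  [/\ \dim S = (2 ^ n)%N,
      forall z, z \in S -> Sym_plus s z,
      ('C(S) = S)%VS &
      exists gens : n.-tuple A, (S : {vspace A}) = agenv <<gens>>%VS].

End Defs.

(* D(<<a_1,...,a_n>>): the bilinear Pfister form is the diagonal form on
   F^(2^n) with entries prod_{i in I} a_i, I ranging over subsets of {1..n} *)
Definition pfister_represents (F : fieldType) (n : nat) (a : 'I_n -> F) (c : F) : Prop :=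
  exists2 v : {ffun {set 'I_n} -> F}, v != 0 &
    c = \sum_(I : {set 'I_n}) (\prod_(i in I) a i) * v I ^+ 2.

(* Main.v *)
(* Write q(x) for the class of s(x)x in A / Alt. The map q is additive, and
   q(bx) = b^2 q(x) if b is symmetric with scalar square. If S is a commutative
   algebra of symmetric elements with scalar squares, generated by n elements and
   of dimension 2^n, then A is a faithful module of dimension 4^n over the local
   Frobenius algebra S (x) S, hence a cyclic one: A = S x0 S. So A is a free left
   S-module with some basis x_j of 2^n elements, and q(sum b_j x_j) is
   sum b_j^2 q(x_j).

   In each quaternion factor there is w_i with u_i w_i + w_i u_i = u_i,
   s(w_i) = w_i and w_i^2 - w_i scalar, where u_i spans Alt(Q_i). Each product of
   distinct w_i^2 has the form s(y)y, and the operators t |-> t - u_i t u_i^-1,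
   which preserve Alt, bring any nontrivial combination of these products down to
   a nonzero scalar. As 1 is not in Alt, the 2^n products are independent modulo
   Alt, so the q(x_j) are independent too. Comparing q(x) = c q(1) on the
   coordinates of x and 1 exhibits c as the square of a nonzero element of S.
   The Pfister form is the squaring map of the algebra generated by the u_i. *)
Require Import Defs.
From Stdlib Require Import Classical_Prop.
From HB Require Import structures.
From mathcomp Require Import all_boot all_order all_algebra all_field.
From mathcomp Require Import zify ring.
Import GRing.Theory.
Local Open Scope ring_scope.

(** * Algebras generated by commuting elements with scalar squares *)

Section QuadraticSpan.
Set Implicit Arguments. Unset Strict Implicit.
Variables (F : fieldType) (E : falgType F).
Implicit Types (vs : seq E) (v x y : E).

(** The product is taken in list order to allow induction on the list. For commuting [v] with scalar
    squares it is the subalgebra they generate, and its dimension reaches [2 ^ size vs] exactly when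
    the monomials are independent. *)
Definition qspan vs : {vspace E} :=
  \big[@prodv F E/1%VS]_(v <- vs) (1 + <[v]>)%VS.

Lemma qspan_cons v vs : qspan (v :: vs) = ((1 + <[v]>) * qspan vs)%VS.
Proof. by rewrite /qspan big_cons. Qed.

Lemma qspan_cat vs ws : qspan (vs ++ ws) = (qspan vs * qspan ws)%VS.
Proof. by rewrite /qspan big_cat. Qed.

Lemma mem_qspan_cons v vs x :
  reflect (exists p q, [/\ p \in qspan vs, q \in qspan vs & x = p + v * q])
    (x \in qspan (v :: vs)).
Proof.
rewrite qspan_cons prodvDl prod1v; apply: (iffP memv_addP).
  case=> p Bp [y vBy ->].
  have/subvP/(_ y vBy)/memv_imgP[q Bq ->] :
      (<[v]> * qspan vs <= amull v @: qspan vs)%VS.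
    apply/prodvP=> _ b /vlineP[k ->] Bb; apply/memv_imgP.
    exists (k *: b); first by rewrite memvZ.
    by rewrite lfunE /= -scalerAl scalerAr.
  by exists p, q; rewrite lfunE.
case=> p [q [Bp Bq ->]]; exists p => //; exists (v * q) => //.
by rewrite memv_mul ?memv_line.
Qed.

Lemma qspan_cons_sum v vs :
  qspan (v :: vs) = (qspan vs + amull v @: qspan vs)%VS.
Proof.
apply/vspaceP=> x; apply/mem_qspan_cons/memv_addP.
  case=> p [q [Bp Bq ->]]; exists p => //; exists (v * q) => //.
  by apply/memv_imgP; exists q => //; rewrite lfunE.
case=> p Bp [_ /memv_imgP[q Bq ->] ->]; exists p, q; split=> //.
by rewrite lfunE.
Qed.

Lemma dim_qspan_cons v vs :
    {in qspan vs &, forall p q, p + v * q = 0 -> p = 0 /\ q = 0} ->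
  \dim (qspan (v :: vs)) = (2 * \dim (qspan vs))%N.
Proof.
move=> direct; rewrite qspan_cons_sum mul2n -addnn dimv_disjoint_sum.
  congr addn; apply: limg_dim_eq; apply/eqP; rewrite -subv0.
  apply/subvP=> q /memv_capP[Bq]; rewrite memv_ker lfunE memv0 /= => /eqP vq0.
  by have [|_ ->] := direct 0 q (mem0v _) Bq; rewrite // vq0 addr0.
apply/eqP; rewrite -subv0; apply/subvP=> p /memv_capP[Bp /memv_imgP[q Bq]].
rewrite lfunE /= => pE; have Bq' : - q \in qspan vs by rewrite memvN.
have pq0 : p + v * - q = 0 by rewrite mulrN -pE subrr.
by have [-> _] := direct _ _ Bp Bq' pq0; rewrite mem0v.
Qed.

Lemma dim_qspan_leq vs : (\dim (qspan vs) <= 2 ^ size vs)%N.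
Proof.
elim: vs => [|v vs IH]; first by rewrite /qspan big_nil dimv1.
rewrite qspan_cons expnS; apply: leq_trans (dim_prodv _ _) (leq_mul _ IH).
apply: leq_trans (dimv_add_leqif _ _) _; rewrite dimv1 dim_vline.
by case: (v != 0).
Qed.

Lemma qspan1 vs : 1 \in qspan vs.
Proof.
elim: vs => [|v vs IH]; first by rewrite /qspan big_nil memv_line.
by apply/mem_qspan_cons; exists 1, 0; rewrite mem0v mulr0 addr0.
Qed.

Lemma sub_qspan_cons v vs : (qspan vs <= qspan (v :: vs))%VS.
Proof.
apply/subvP=> x Bx; apply/mem_qspan_cons; exists x, 0.
by rewrite mem0v mulr0 addr0.
Qed.

Lemma mem_qspan vs v : v \in vs -> v \in qspan vs.
Proof.
elim: vs => // w vs IH; rewrite inE => /predU1P[->|/IH vsv].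
  by apply/mem_qspan_cons; exists 0, 1; rewrite mem0v qspan1 mulr1 add0r.
exact: subvP (sub_qspan_cons _ _) _ vsv.
Qed.

Lemma cent_qspan vs x : {in vs, forall v, v * x = x * v} ->
  {in qspan vs, forall y, y * x = x * y}.
Proof.
elim: vs => [|v vs IH] cx y.
  by rewrite /qspan big_nil => /vlineP[k ->]; rewrite -scalerAl mul1r -scalerAr mulr1.
case/mem_qspan_cons=> p [q [Bp Bq ->]].
have cx' : {in vs, forall v, v * x = x * v}.
  by move=> w vsw; apply: cx; rewrite inE vsw orbT.
rewrite mulrDl mulrDr (IH cx' p Bp) -mulrA (IH cx' q Bq) mulrA cx ?mem_head //.
by rewrite mulrA.
Qed.

Lemma qspan_comm vs : {in vs &, commutative *%R} ->
  {in qspan vs &, commutative *%R}.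
Proof.
move=> cvs x y Bx By; apply: cent_qspan Bx => v vsv; apply/esym.
by apply: cent_qspan By => w vsw; apply: cvs.
Qed.

Lemma qspanM vs : {in vs &, commutative *%R} ->
  {in vs, forall v, v * v \in 1%VS} -> {in qspan vs &, forall x y, x * y \in qspan vs}.
Proof.
elim: vs => [|v vs IH] cvs sqvs.
  move=> x y; rewrite /qspan big_nil => /vlineP[k ->] By.
  by rewrite -scalerAl mul1r memvZ.
have cvs' := sub_in2 (@mem_behead _ (v :: vs)) cvs.
have sqvs' := sub_in1 (@mem_behead _ (v :: vs)) sqvs.
have cv : {in qspan vs, forall y, y * v = v * y}.
  by apply: cent_qspan => w vsw; apply: cvs; rewrite !inE ?vsw ?eqxx ?orbT.
have [g vvE] := vlineP _ _ (sqvs v (mem_head _ _)).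
move=> _ _ /mem_qspan_cons[p [q [Bp Bq ->]]] /mem_qspan_cons[r [t [Br Bt ->]]].
apply/mem_qspan_cons; exists (p * r + g *: (q * t)), (p * t + q * r).
split; [by rewrite memvD ?memvZ ?IH | by rewrite memvD ?IH |].
rewrite mulrDl !mulrDr !mulrA (cv p Bp) -[v * q * v]mulrA (cv q Bq) mulrA vvE.
by rewrite -!scalerAl !mul1r [v * q * r + _]addrC addrACA -!mulrA.
Qed.

Hypothesis char2 : 2%N \in [pchar F].

Lemma addvv_char2 x : x + x = 0.
Proof. by rewrite -mulr2n -scaler_nat (pcharf0 char2) scale0r. Qed.

(** Cross terms cancel in characteristic two, so squaring is additive on a commutative algebra. *)
Lemma qspan_sq vs : {in vs &, commutative *%R} ->
  {in vs, forall v, v * v \in 1%VS} -> {in qspan vs, forall x, x * x \in 1%VS}.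
Proof.
elim: vs => [|v vs IH] cvs sqvs.
  by rewrite /qspan big_nil => x Bx; rewrite -(prodv1 1%VS) memv_mul.
have cvs' := sub_in2 (@mem_behead _ (v :: vs)) cvs.
have sqvs' := sub_in1 (@mem_behead _ (v :: vs)) sqvs.
have cv : {in qspan vs, forall y, y * v = v * y}.
  by apply: cent_qspan => w vsw; apply: cvs; rewrite !inE ?vsw ?eqxx ?orbT.
have [g vvE] := vlineP _ _ (sqvs v (mem_head _ _)).
move=> _ /mem_qspan_cons[p [q [Bp Bq ->]]].
rewrite mulrDl !mulrDr !mulrA (cv p Bp) -[v * q * v]mulrA (cv q Bq) mulrA vvE.
rewrite -[v * p * q]mulrA -[v * q * p]mulrA (@qspan_comm _ cvs' q p) //.
rewrite addrACA [v * _ + _]addrC addrACA addvv_char2 addr0.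
by rewrite -!scalerAl mul1r memvD ?memvZ ?IH.
Qed.

(* [qspan vs] is a local Frobenius algebra; [z] generates its socle. *)
Lemma qspan_socle vs : {in vs &, commutative *%R} ->
    {in vs, forall v, v * v \in 1%VS} -> \dim (qspan vs) = (2 ^ size vs)%N ->
  exists z, [/\ z \in qspan vs, z != 0 &
    {in qspan vs, forall b, b != 0 -> exists2 c, c \in qspan vs & c * b = z}].
Proof.
elim: vs => [|v vs IH] cvs sqvs dimB.
  exists 1; split; rewrite ?oner_eq0 ?qspan1 // => b; rewrite {1}/qspan big_nil.
  case/vlineP=> k -> nzk; have nzk' : k != 0.
    by apply: contra nzk => /eqP->; rewrite scale0r.
  exists (k^-1 *: 1); first by rewrite memvZ ?qspan1.
  by rewrite -scalerAl mul1r scalerA mulVf // scale1r.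
have cvs' := sub_in2 (@mem_behead _ (v :: vs)) cvs.
have sqvs' := sub_in1 (@mem_behead _ (v :: vs)) sqvs.
have cv : {in qspan vs, forall y, y * v = v * y}.
  by apply: cent_qspan => w vsw; apply: cvs; rewrite !inE ?vsw ?eqxx ?orbT.
have [g vvE] := vlineP _ _ (sqvs v (mem_head _ _)).
set B := qspan vs in cv *; set B' := qspan (v :: vs) in dimB *.
have B'E : B' = (B + (amull v @: B))%VS by apply: qspan_cons_sum.
have dB := dim_qspan_leq vs; rewrite -/B in dB.
have dvB := limg_ker_dim (amull v) B.
have dimB2 : \dim B' = (2 * 2 ^ size vs)%N by rewrite dimB -expnS.
have dsum := dimv_sum_cap B (amull v @: B); rewrite -B'E dimB2 in dsum.
(* [B] and [v B] each have at most half the dimension of their sum [B'], so the sum is direct and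
   [v] acts injectively on [B]. *)
have [dimI0 dimK0] : \dim (B :&: (amull v @: B)) = 0%N /\
    \dim (B :&: lker (amull v)) = 0%N by lia.
move/eqP: dimI0; move/eqP: dimK0; rewrite !dimv_eq0 => /eqP K0 /eqP I0.
have inj_v q : q \in B -> v * q = 0 -> q = 0.
  by move=> Bq vq0; apply/eqP; rewrite -memv0 -K0 memv_cap Bq memv_ker lfunE /= vq0.
have direct p q : p \in B -> q \in B -> p + v * q = 0 -> p = 0 /\ q = 0.
  move=> Bp Bq pq0; have vqp : v * q = p.
    by apply: (addrI p); rewrite pq0 addvv_char2.
  have p0 : p = 0.
    apply/eqP; rewrite -memv0 -I0 memv_cap Bp -vqp; apply/memv_imgP.
    by exists q; rewrite ?lfunE.
  by split=> //; apply: inj_v; rewrite // vqp.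
have dimB0 : \dim B = (2 ^ size vs)%N by lia.
have [z [Bz nz_z socz]] := IH cvs' sqvs' dimB0.
have sBB' := subvP (sub_qspan_cons v vs).
have B'v : v \in B' by apply: mem_qspan; rewrite mem_head.
have B'M := @qspanM _ cvs sqvs; rewrite -/B' in B'M.
have BM := @qspanM _ cvs' sqvs'; rewrite -/B in BM.
have cB := @qspan_comm _ cvs'; rewrite -/B in cB.
have sqB := @qspan_sq _ cvs' sqvs'; rewrite -/B in sqB.
(* If [g] has a square root [b0] in [B], then [h = v + b0] squares to zero, [B' = B + h B], and the
   socle moves to [z * h]. Otherwise [z] still generates it. *)
have [[b0 Bb0 b0E]|no_root] := classic (exists2 b, b \in B & b * b = g%:A).
- pose h := v + b0; have hh0 : h * h = 0.
    rewrite mulrDl !mulrDr vvE b0E (cv _ Bb0).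
    by rewrite [X in _ + X]addrC addvv_char2.
  have B'h : h \in B' by rewrite memvD // sBB'.
  have ch : {in B, forall y, h * y = y * h}.
    by move=> y By; rewrite mulrDl mulrDr (cv y By) (cB _ _ By Bb0).
  exists (z * h); split; first by rewrite B'M // sBB'.
    apply/eqP; rewrite mulrDr (cv z Bz) addrC => zh0.
    by case: (direct _ _ (BM _ _ Bz Bb0) Bz zh0) => _ z0; rewrite z0 eqxx in nz_z.
  move=> _ /mem_qspan_cons[p [q [Bp Bq ->]]] nzb.
  have -> : p + v * q = (p + b0 * q) + h * q.
    by rewrite mulrDl addrACA addvv_char2 addr0.
  have Bp' : p + b0 * q \in B by rewrite memvD ?BM.
  have [p'0|nzp'] := eqVneq (p + b0 * q) 0.
    have nzq : q != 0.
      apply: contra nzb => /eqP q0; move: p'0.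
      by rewrite q0 !mulr0 !addr0 => ->.
    have [c Bc cqz] := socz q Bq nzq.
    by exists c; rewrite ?sBB' // p'0 add0r ch // mulrA cqz.
  have [c Bc cpz] := socz _ Bp' nzp'.
  exists (c * h); first by rewrite B'M // sBB'.
  by rewrite mulrDr -!mulrA (mulrA h h) hh0 mul0r mulr0 addr0 ch // mulrA cpz.
have gnz : g != 0.
  by apply/eqP=> g0; case: no_root; exists 0; rewrite ?mem0v // g0 mulr0 scale0r.
exists z; split=> //; first exact: sBB'.
move=> _ /mem_qspan_cons[p [q [Bp Bq ->]]] nzb.
have [q0|nzq] := eqVneq q 0.
  move: nzb; rewrite q0 mulr0 addr0 => nzp.
  by have [c Bc cpz] := socz p Bp nzp; exists c; rewrite ?sBB'.
have [c Bc cqz] := socz q Bq nzq.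
(* Multiplying by [c] turns the coefficient of [v] into [z]; it remains to carry [c * p + v * z] to
   [z]. *)
have [e B'e eE] : exists2 e, e \in B' & e * (c * p + v * z) = z.
  have Bcp : c * p \in B by rewrite BM.
  have [cp0|nzcp] := eqVneq (c * p) 0.
    exists (g^-1 *: v); first by rewrite memvZ.
    rewrite cp0 add0r -scalerAl mulrA vvE -scalerAl mul1r scalerA mulVf //.
    by rewrite scale1r.
  have [d Bd dcpz] := socz _ Bcp nzcp.
  have [dz0|nzdz] := eqVneq (d * z) 0.
    exists d; first exact: sBB'.
    by rewrite mulrDr dcpz mulrA (cv d Bd) -mulrA dz0 mulr0 addr0.
  have [k ddE] := vlineP _ _ (sqB d Bd).
  have [f Bf fdzz] := socz _ (BM _ _ Bd Bz) nzdz.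
  (* [f * d] fixes [z], so its square, which has the factor [k], cannot vanish. *)
  have nzk : k != 0.
    apply: contra nz_z => /eqP k0; rewrite -fdzz -fdzz !mulrA -(mulrA f d f).
    by rewrite (cB d f) // mulrA -(mulrA _ d d) ddE k0 scale0r mulr0 !mul0r.
  (* [k'] is the square of [1 + v * d]; were it zero, [k^-1 *: d] would be a square root of [g] in
     [B]. *)
  pose k' := 1 + k * g; have nzk' : k' != 0.
    apply/eqP=> k'0; case: no_root; exists (k^-1 *: d); first by rewrite memvZ.
    rewrite -scalerAl -scalerAr ddE !scalerA; congr (_ *: 1).
    rewrite mulfVK //; apply: (mulfI nzk); rewrite divff //.
    rewrite -[LHS]addr0 -k'0 /k' addrA.
    by rewrite -mulr2n (pcharf0 char2) add0r.
  have wE : d * (c * p + v * z) = (1 + v * d) * z.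
    by rewrite mulrDr dcpz mulrA (cv d Bd) mulrDl mul1r.
  have wwE : (1 + v * d) * (1 + v * d) = k'%:A.
    rewrite mulrDl !mulrDr !mul1r mulr1 addrA -(addrA 1) addvv_char2 addr0.
    rewrite mulrA -(mulrA v d v) (cv d Bd) mulrA vvE -scalerAl mul1r -scalerAl.
    by rewrite ddE scalerA mulrC scalerDl scale1r.
  exists (k'^-1 *: (1 + v * d) * d).
    apply: (B'M _ _ _ (sBB' _ Bd)); rewrite memvZ // memvD ?qspan1 //.
    by rewrite B'M // sBB'.
  rewrite -mulrA wE -scalerAl mulrA wwE -scalerAl mul1r scalerA mulVf //.
  by rewrite scale1r.
exists (e * c); first by rewrite B'M // sBB'.
by rewrite -mulrA mulrDr (mulrA c v) (cv c Bc) -(mulrA v c q) cqz.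
Qed.
End QuadraticSpan.

(** * Independence of two-sided multiplications in a central simple algebra *)

Section CentralSimple.
Set Implicit Arguments. Unset Strict Implicit.
Variables (F : fieldType) (A : falgType F).

Lemma prodv_ind (U V : {vspace A}) (P : A -> Prop) :
    P 0 -> (forall x y, P x -> P y -> P (x + y)) ->
    {in U & V, forall u v, P (u * v)} ->
  {in (U * V)%VS, forall x, P x}.
Proof.
move=> P0 PD PM x; rewrite [@prodv F A]unlock => /(@coord_span _ _ _ (in_tuple _)) ->.
apply: (big_ind P) => // i _ /=.
have /allpairsP[[u v] /= [Uu Vv ->]] := mem_nth 0 (ltn_ord i).
by rewrite scalerAl; apply: PM; rewrite ?memvZ // vbasis_mem.
Qed.

Hypothesis csA : central_simple A.

(** This is the injectivity of the map from [A] tensor its opposite to ['End(A)]. By simplicity the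
    leading coefficient of a relation can be made 1; commutators then give shorter relations, so the
    other coefficients are central, contrary to [free xs]. *)
Lemma central_simple_indep (xs : seq A) (t : A -> A) :
  free xs -> (forall y, \sum_(x <- xs) x * y * t x = 0) ->
  {in xs, forall x, t x = 0}.
Proof.
elim: xs t => // x0 xs IH t; rewrite free_cons => /andP[xs'x0 fr_xs] rel.
have xs_neq x : x \in xs -> x != x0.
  by move=> xsx; apply: contraNneq xs'x0 => <-; apply: memv_span.
have [tx0|nz_t] := eqVneq (t x0) 0.
  move=> x; rewrite inE => /predU1P[-> //|]; apply: (IH t fr_xs) => y.
  by have := rel y; rewrite big_cons tx0 mulr0 add0r.
(* [P a] says that some relation has coefficient [a] at [x0]; such [a] form a two-sided ideal. *)
pose P a := exists2 t', forall y, \sum_(x <- x0 :: xs) x * y * t' x = 0 & t' x0 = a.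
have [simple_A cA] := (csA.2, csA.1).
have P0 : P 0 by exists (fun=> 0) => // y; rewrite big1 // => x _; rewrite mulr0.
have PD a b : P a -> P b -> P (a + b).
  move=> [t1 r1 <-] [t2 r2 <-]; exists (fun x => t1 x + t2 x) => // y.
  by under eq_bigr do rewrite mulrDr; rewrite big_split /= r1 r2 addr0.
have PMl a b : P b -> P (a * b).
  move=> [t1 r1 <-]; exists (fun x => a * t1 x) => // y.
  by under eq_bigr do rewrite mulrA -(mulrA _ y a); apply: r1.
have PMr a b : P a -> P (a * b).
  move=> [t1 r1 <-]; exists (fun x => t1 x * b) => // y.
  by under eq_bigr do rewrite mulrA; rewrite -mulr_suml r1 mul0r.
pose I := ({:A} * (<[t x0]> * {:A}))%VS.
have PI : {in I, forall a, P a}.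
  apply: prodv_ind => // a w _ Iw; move: w Iw a.
  apply: (@prodv_ind _ _ (fun w => forall a, P (a * w))) => [a|b c Pb Pc a|].
  - by rewrite mulr0.
  - by rewrite mulrDr; apply: PD.
  move=> _ b /vlineP[k ->] _ a; apply/PMl/PMr; rewrite -[t x0]mul1r scalerAl.
  by apply: PMl; exists t.
have It : t x0 \in I.
  rewrite -[t x0]mul1r; apply: memv_mul; rewrite ?memvf //.
  by rewrite -{1}[t x0]mulr1; apply: memv_mul; rewrite ?memvf // memv_line.
have lI : ({:A} * I <= I)%VS by rewrite /I !prodvA !prodvSl ?subvf.
have rI : (I * {:A} <= I)%VS by rewrite /I -!prodvA !prodvSr ?subvf.
have [I0|If] := simple_A I (subvf _) lI rI.
  by move: nz_t; rewrite -memv0 -I0 It.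
have [t1 r1 t1x0] : P 1 by apply: PI; rewrite If memvf.
(* The relation at [y] times [z], minus the relation at [y * z], has no [x0] term, since the
   coefficient there is 1. *)
have t1_central x : x \in xs -> exists k, t1 x = k%:A.
  move=> xsx; apply/vlineP; rewrite -cA; apply/memv_capP; split; rewrite ?memvf //.
  apply/centvP=> z _; apply/eqP; rewrite -subr_eq0; apply/eqP.
  apply: (IH (fun x => t1 x * z - z * t1 x) fr_xs) xsx => y.
  have := congr1 (fun a => a * z) (r1 y); rewrite mulr_suml mul0r.
  have := r1 (y * z); rewrite !big_cons t1x0 !mulr1 => e1 e2.
  under eq_bigr => x' _ do rewrite mulrBr !mulrA.
  rewrite sumrB; apply/eqP; rewrite subr_eq0; apply/eqP.
  apply: (addrI (x0 * y * z)); rewrite e2 -[LHS]e1 mulrA; congr (_ + _).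
  by apply: eq_bigr => x' _; rewrite !mulrA.
case/negP: xs'x0; have := r1 1; rewrite big_cons t1x0 !mulr1 => /eqP.
rewrite addr_eq0 => /eqP->; rewrite memvN big_seq; apply: memv_suml => x xsx.
have [k ->] := t1_central x xsx.
by rewrite mulr1 -scalerAr mulr1 memvZ // memv_span.
Qed.

End CentralSimple.

(** * [A] as a cyclic bimodule over a commutative subalgebra *)

Section Bimodule.
Set Implicit Arguments. Unset Strict Implicit.
Import FalgLfun.
Variables (F : fieldType) (A : falgType F).

(** Multiplicativity is asked of commuting pairs only, because products in ['End(A)] compose from
    left to right, so that [amull] reverses products. *)
Lemma qspan_map (E : falgType F) (f : {linear A -> E}) (vs : seq A) :
    {in vs &, commutative *%R} ->
    f 1 = 1 -> (forall x y, x * y = y * x -> f (x * y) = f x * f y) ->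
  {in qspan vs, forall x, f x \in qspan (map f vs)}.
Proof.
move=> + f1 fM; elim: vs => [|v vs IH] cvs.
  move=> x; rewrite /qspan !big_nil => /vlineP[k ->].
  by rewrite linearZ f1 memvZ ?memv_line.
have cvs' := sub_in2 (@mem_behead _ (v :: vs)) cvs.
move=> _ /mem_qspan_cons[p [q [Bp Bq ->]]]; rewrite linearD /=.
apply/mem_qspan_cons; exists (f p), (f q); split; rewrite ?IH // fM //.
apply/esym; apply: cent_qspan Bq => w vsw.
by apply: cvs; rewrite inE ?vsw ?eqxx ?orbT.
Qed.

Lemma amullE (u x : A) : amull u x = u * x. Proof. exact: lfunE. Qed.
Lemma amulrE (u x : A) : amulr u x = x * u. Proof. exact: lfunE. Qed.

Lemma amullr_comm (u v : A) : amull u * amulr v = amulr v * amull u.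
Proof. by apply/lfunP => x; rewrite !lfun_mulE !amullE !amulrE mulrA. Qed.

Lemma amullM_comm (u v : A) : u * v = v * u -> amull (u * v) = amull u * amull v.
Proof.
by move=> cuv; apply/lfunP=> x; rewrite lfun_mulE !amullE cuv mulrA.
Qed.

Lemma amull1_End : amull 1 = 1 :> 'End(A).
Proof. by rewrite amull1. Qed.

(* [A] is a faithful module over [S * S^op] of the same dimension, and an element
   not killed by the socle of the local algebra [S * S^op] generates it. *)
Lemma bimodule_cyclic (vs : seq A) : 2%N \in [pchar F] -> central_simple A ->
    {in vs &, commutative *%R} -> {in vs, forall v, v * v \in 1%VS} ->
    \dim (qspan vs) = (2 ^ size vs)%N -> \dim {:A} = (4 ^ size vs)%N ->
  exists x0, forall y, exists2 s : 'I_(\dim (qspan vs)) -> A,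
    forall j, s j \in qspan vs & y = \sum_j s j * x0 * (vbasis (qspan vs))`_j.
Proof.
move=> char2 csA cvs sqvs dimS dimA; set S := qspan vs in dimS *.
pose ws := map (@amull F A) vs ++ map (@amulr F A) vs.
have size_ws : size ws = (size vs).*2 by rewrite size_cat !size_map addnn.
have dimAE : (\dim S * \dim S = 4 ^ size vs)%N.
  by rewrite dimS -expnD addnn -mul2n expnM.
have dimME : dim 'M[F]_(\dim S) = (4 ^ size vs)%N by rewrite dim_matrix.
have dimWA : (2 ^ size ws = 4 ^ size vs)%N by rewrite size_ws -mul2n expnM.
have LS : {in S, forall s, amull s \in qspan (map (@amull F A) vs)}.
  exact: qspan_map cvs amull1_End amullM_comm.
have RS : {in S, forall s, amulr s \in qspan (map (@amulr F A) vs)}.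
  apply: qspan_map cvs _ _; first exact: rmorph1.
  by move=> x y _; rewrite rmorphM.
pose X := vbasis S.
have SX i : X`_i \in S.
  have [lt_i|ge_i] := ltnP i (size X); first by rewrite vbasis_mem ?mem_nth.
  by rewrite nth_default ?mem0v.
(* A matrix encodes an element of [S] tensor its opposite in the basis [X]; [phi] is its action on
   [A]. *)
pose phi (c : 'M[F]_(\dim S)) : 'End(A) :=
  \sum_i \sum_j c i j *: (amull X`_i * amulr X`_j).
have phi_lin : linear phi.
  move=> k c d; rewrite /phi scaler_sumr -big_split; apply: eq_bigr => i _ /=.
  rewrite scaler_sumr -big_split; apply: eq_bigr => j _ /=.
  by rewrite !mxE scalerDl scalerA.
pose phiL := GRing.isLinear.Build F 'M[F]_(\dim S) 'End(A) *:%R phi phi_lin.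
pose Phi : {linear 'M[F]_(\dim S) -> 'End(A)} := HB.pack phi phiL.
have phiE c x : phi c x =
    \sum_(i < \dim S) X`_i * x * (\sum_(j < \dim S) c i j *: X`_j).
  rewrite sum_lfunE; apply: eq_bigr => i _; rewrite sum_lfunE mulr_sumr.
  apply: eq_bigr => j _; rewrite scale_lfunE lfun_mulE amullE amulrE.
  by rewrite -scalerAr.
have ker_Phi : lker (linfun Phi) == 0%VS.
  rewrite -subv0; apply/subvP=> c; rewrite memv_ker lfunE memv0 => /eqP c0.
  have Xfree : free X := basis_free (vbasisP S).
  (* [central_simple_indep] wants coefficients indexed by elements of [A]; [t] sends a basis vector
     to its row, the basis having no repetitions. *)
  pose t x := \sum_(i < \dim S) (if x == X`_i then \sum_(j < \dim S) c i j *: X`_j else 0).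
  have tE (i : 'I_(\dim S)) : t X`_i = \sum_(j < \dim S) c i j *: X`_j.
    rewrite /t (bigD1 i) //= eqxx [X in _ + X]big1 ?addr0 // => j nji.
    by rewrite nth_uniq ?size_tuple ?ltn_ord ?free_uniq // eq_sym val_eqE (negPf nji).
  have t0 : {in X, forall x, t x = 0}.
    apply: (central_simple_indep csA Xfree) => y; rewrite big_tuple.
    under eq_bigr => i _ do rewrite (tnth_nth 0) tE.
    by rewrite -phiE [phi c]c0 lfunE.
  apply/eqP/matrixP=> i j; rewrite mxE; move/freeP: Xfree; apply.
  by rewrite -tE t0 // mem_nth ?size_tuple.
pose B := qspan ws.
(* The image lies in [B], whose dimension is at most that of the matrix space; since [Phi] is
   injective, the two agree. *)
have PhiB : limg (linfun Phi) = B.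
  apply/eqP; rewrite eqEdim; apply/andP; split.
    apply/subvP=> _ /memv_imgP[c _ ->]; rewrite lfunE /= /phi.
    apply: memv_suml => i _; apply: memv_suml => j _; rewrite memvZ //.
    by rewrite /B /ws qspan_cat memv_mul ?LS ?RS.
  rewrite limg_dim_eq ?(eqP ker_Phi) ?capv0 // dimvf dimME.
  by rewrite (leq_trans (dim_qspan_leq _)) ?dimWA.
have dimB : \dim B = (4 ^ size vs)%N.
  by rewrite -PhiB limg_dim_eq ?(eqP ker_Phi) ?capv0 // dimvf dimME.
have cws : {in ws &, commutative *%R}.
  move=> f g; rewrite !mem_cat.
  case/orP=> /mapP[u vsu ->]; case/orP=> /mapP[v vsv ->].
  - have cuv := cvs _ _ vsu vsv.
    by rewrite -(amullM_comm cuv) -(amullM_comm (esym cuv)) cuv.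
  - exact: amullr_comm.
  - by rewrite amullr_comm.
  - by rewrite -rmorphM cvs // rmorphM.
have sqws : {in ws, forall f, f * f \in 1%VS}.
  move=> f; rewrite mem_cat; case/orP=> /mapP[u vsu ->].
    rewrite -(amullM_comm erefl); have [k ->] := vlineP _ _ (sqvs u vsu).
    by rewrite linearZ /= amull1_End memvZ ?memv_line.
  have -> : amulr u * amulr u = amulr (u * u) by rewrite rmorphM.
  have [k ->] := vlineP _ _ (sqvs u vsu).
  by rewrite linearZ /= rmorph1 memvZ ?memv_line.
have [z [Bz nz_z socz]] := qspan_socle char2 cws sqws (etrans dimB (esym dimWA)).
have /lfunPn[x0] := nz_z; rewrite lfunE /= => zx0.
pose psi c := phi c x0.
have psi_lin : linear psi.
  by move=> k c d; rewrite /psi phi_lin add_lfunE scale_lfunE.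
pose psiL := GRing.isLinear.Build F 'M[F]_(\dim S) A *:%R psi psi_lin.
pose Psi : {linear 'M[F]_(\dim S) -> A} := HB.pack psi psiL.
(* A nonzero [phi c] has [z] among its multiples, so it cannot kill [x0]. *)
have ker_Psi : lker (linfun Psi) = 0%VS.
  apply/eqP; rewrite -subv0; apply/subvP=> c; rewrite memv_ker lfunE memv0 => /eqP c0.
  rewrite -memv0 -(eqP ker_Phi) memv_ker lfunE.
  apply: contraNT zx0 => nz_c; have Bc : phi c \in B.
    by rewrite -PhiB; apply/memv_imgP; exists c; rewrite ?memvf ?lfunE.
  have [e Be <-] := socz _ Bc nz_c; rewrite (qspan_comm cws Be Bc) lfun_mulE.
  by rewrite [phi c x0]c0 linear0.
have limgPsi : limg (linfun Psi) = fullv.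
  apply/eqP; rewrite eqEdim subvf limg_dim_eq ?ker_Psi ?capv0 //.
  by rewrite dimA dimvf dimME leqnn.
exists x0 => y; have: y \in limg (linfun Psi) by rewrite limgPsi memvf.
case/memv_imgP=> c _ ->; rewrite lfunE /= /psi phiE.
exists (fun j => \sum_(i < \dim S) c i j *: X`_i).
  by move=> j; apply: memv_suml => i _; rewrite memvZ.
under [LHS]eq_bigr => i _ do rewrite mulr_sumr.
rewrite exchange_big /=; apply: eq_bigr => j _; rewrite !mulr_suml.
by apply: eq_bigr => i _; rewrite -scalerAr -!scalerAl.
Qed.
End Bimodule.

(** * Representation of scalars modulo alternating elements *)

Section Represented.
Set Implicit Arguments. Unset Strict Implicit.
Variables (F : fieldType) (A : falgType F) (s : A -> A).
Hypothesis char2 : 2%N \in [pchar F].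
Hypothesis csA : central_simple A.
Hypothesis sI : is_involution s.

Lemma inv_lin : linear s. Proof. by case: sI. Qed.
Lemma invM x y : s (x * y) = s y * s x. Proof. by case: sI. Qed.
Lemma inv1 : s 1 = 1. Proof. by case: sI. Qed.
Lemma invK x : s (s x) = x. Proof. by case: sI. Qed.

HB.instance Definition _ := GRing.isLinear.Build F A A *:%R s inv_lin.

Lemma opp_char2 (x : A) : - x = x.
Proof. by apply/eqP; rewrite eq_sym -addr_eq0 addvv_char2. Qed.

Definition altv : {vspace A} := limg (linfun s - \1%VF).

Lemma altvP z : reflect (Alt s z) (z \in altv).
Proof.
apply: (iffP idP) => [/memv_imgP[x _ ->]|[x ->]].
  by exists x; rewrite !lfun_simp.
by apply/memv_imgP; exists x; rewrite ?memvf // !lfun_simp.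
Qed.

(** Stands for the quotient map from [A] to [A / Alt]: a linear endomorphism whose kernel is
    [altv]. *)
Definition mod_alt : 'End(A) := \1%VF - projv altv.

Lemma mod_alt_eq0 z : (mod_alt z == 0) = (z \in altv).
Proof.
rewrite !lfun_simp /= subr_eq0; apply/eqP/idP => [->|/projv_id-> //].
exact: memv_proj.
Qed.

Definition sqnorm x := mod_alt (s x * x).

Lemma sqnorm0 : sqnorm 0 = 0.
Proof. by rewrite /sqnorm mulr0 linear0. Qed.

(** The cross term is [s a + a] with [a = s y * x], hence alternating in characteristic two. *)
Lemma sqnormD : {morph sqnorm : x y / x + y}.
Proof.
move=> x y; have cross : mod_alt (s x * y + s y * x) = 0.
  apply/eqP; rewrite mod_alt_eq0; apply/altvP; exists (s y * x).
  by rewrite invM invK opp_char2.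
rewrite /sqnorm linearD /= mulrDl !mulrDr [X in _ + X]addrC addrACA linearD /= cross.
by rewrite addr0 linearD.
Qed.

(** [T] tests independence modulo [Alt]: it embeds in the quotient, and its image lies in the span
    of the [p j], since all classes of [s y * y] do. As [\dim T] is at least the number of the
    [p j], these are free, and the coordinates of [x] and 1 can be compared. *)
Lemma represented_square (vs : seq A) (T : {vspace A}) (c : F) :
    {in vs &, commutative *%R} -> {in vs, forall v, v * v \in 1%VS} ->
    {in qspan vs, forall x, s x = x} ->
    \dim (qspan vs) = (2 ^ size vs)%N -> \dim {:A} = (4 ^ size vs)%N ->
    ~ Alt s 1 -> {in T, forall t, Alt s t -> t = 0} ->
    (2 ^ size vs <= \dim T)%N ->
    (forall V : {vspace A}, (forall y, s y * y \in V) -> (T <= V)%VS) ->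
    represents s c ->
  exists2 x, x \in qspan vs /\ x != 0 & x * x = c%:A.
Proof.
move=> cvs sqvs symS dimS dimA orth T_alt dimT T_sq [x nz_x alt_x].
have [x0 gen] := bimodule_cyclic char2 csA cvs sqvs dimS dimA.
set S := qspan vs in symS dimS gen *.
pose p (j : 'I_(\dim S)) := sqnorm (x0 * (vbasis S)`_j).
have sqS b : b \in S -> exists k, b * b = k%:A.
  by move=> Sb; apply/vlineP; apply: qspan_sq Sb.
have sqnormE (t : 'I_(\dim S) -> A) k : (forall j, t j \in S) ->
    (forall j, t j * t j = (k j)%:A) ->
  sqnorm (\sum_(j < \dim S) t j * x0 * (vbasis S)`_j) = \sum_(j < \dim S) k j *: p j.
  move=> St tt; rewrite (big_morph _ sqnormD sqnorm0); apply: eq_bigr => j _.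
  rewrite /p /sqnorm -[t j * x0 * _]mulrA invM (symS _ (St j)) mulrA.
  by rewrite -[_ * t j * t j]mulrA tt -scalerAr mulr1 -scalerAl linearZ.
have decomp y : exists t k, [/\ forall j, t j \in S, forall j, t j * t j = (k j)%:A,
    y = \sum_(j < \dim S) t j * x0 * (vbasis S)`_j & sqnorm y = \sum_(j < \dim S) k j *: p j].
  have [t St yE] := gen y.
  have [k kE] := fin_all_exists (fun j => sqS _ (St j)).
  by exists t, k; split=> //; rewrite yE; apply: sqnormE.
pose ptup := [tuple p j | j < \dim S].
have p_free : free ptup.
  have kerT : (T :&: lker mod_alt = 0)%VS.
    apply/eqP; rewrite -subv0; apply/subvP=> y /memv_capP[Ty].
    by rewrite memv_ker mod_alt_eq0 memv0 => /altvP/(T_alt y Ty)/eqP.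
  have T_p : (mod_alt @: T <= <<ptup>>)%VS.
    apply/subvP=> _ /memv_imgP[y Ty ->]; rewrite memv_preim; move: y Ty.
    apply/subvP/T_sq => y; rewrite -memv_preim.
    have [t [k [_ _ _]]] := decomp y; rewrite /sqnorm => ->.
    apply: memv_suml => j _; rewrite memvZ // memv_span //.
    by apply/tnthP; exists j; rewrite tnth_mktuple.
  rewrite /free eqn_leq dim_span size_tuple.
  apply: leq_trans (leq_trans (eq_leq dimS) dimT) _.
  by rewrite -(limg_dim_eq kerT) dimvS.
have pP k : \sum_(j < \dim S) k j *: p j = 0 -> forall j, k j = 0.
  move=> kp0; move/freeP: p_free; apply; rewrite -[RHS]kp0.
  by apply: eq_bigr => j _; rewrite -tnth_nth tnth_mktuple.
have [t [k [St tt xE qx]]] := decomp x.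
have [d [l [Sd dd oneE q1]]] := decomp 1.
have q1E : sqnorm 1 = mod_alt 1 by rewrite /sqnorm inv1 mulr1.
(* The assumption on [x] says that [sqnorm x = c *: sqnorm 1]. *)
have kE j : k j = c * l j.
  apply/eqP; rewrite -subr_eq0; apply/eqP; move: j.
  apply: pP; under eq_bigr => j _ do rewrite scalerBl -scalerA.
  rewrite sumrB -scaler_sumr -q1 -qx q1E /sqnorm -linearZ -linearB opp_char2.
  by apply/eqP; rewrite mod_alt_eq0; apply/altvP.
(* For [c = 0] every [t j] squares to zero, and one of them is nonzero because [x] is. *)
have [c0|nz_c] := eqVneq c 0.
  case: (pickP (fun j => t j != 0)) => [j nz_tj|t0].
    by exists (t j) => //; rewrite tt kE c0 mul0r.
  case/eqP: nz_x; rewrite xE big1 // => j _.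
  by have /negbFE/eqP-> := t0 j; rewrite !mul0r.
case: (pickP (fun j => l j != 0)) => [j nz_lj|l0]; last first.
  case: orth; apply/altvP; rewrite -mod_alt_eq0 -q1E q1 big1 // => j _.
  by have /negbFE/eqP-> := l0 j; rewrite scale0r.
(* [t j] and [d j] have squares [c * l j] and [l j], so their product divided by [l j] has square
   [c]. *)
pose b := (l j)^-1 *: (t j * d j).
have bb : b * b = c%:A.
  rewrite -scalerAl -scalerAr scalerA mulrA -(mulrA (t j) (d j)).
  rewrite (qspan_comm cvs (Sd j) (St j)) mulrA -(mulrA _ (d j)) tt dd kE.
  rewrite -scalerAl mul1r !scalerA; congr (_ *: 1).
  by field.
exists b => //; split; first by rewrite memvZ // (qspanM cvs sqvs).
apply: contraNneq nz_c => b0; move: bb; rewrite b0 mul0r => /esym/eqP.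
by rewrite scaler_eq0 oner_eq0 orbF.
Qed.

End Represented.

(** * Quaternion subalgebras in characteristic two *)

Section Quaternion.
Set Implicit Arguments. Unset Strict Implicit.
Variables (F : fieldType) (A : falgType F).
Hypothesis char2 : 2%N \in [pchar F].

Definition adv (u : A) : 'End(A) := (amull u + amulr u)%VF.

Lemma advE u x : adv u x = u * x + x * u.
Proof. by rewrite !lfun_simp. Qed.

(** Commutation with [u] is a derivation, so its value at [x * x] is [u * x + x * u]. *)
Lemma commutator_square (u x : A) :
  u * x + x * u = u -> u * (x * x) + x * x * u = u.
Proof.
move=> uxu; have ux : u * x = x * u + u by rewrite -{3}uxu addrCA addvv_char2 ?addr0.
rewrite mulrA ux mulrDl -(mulrA x u x) ux mulrDr mulrA addrA.
by rewrite -(addrA (x * x * u)) addvv_char2 // addr0 addrAC addvv_char2 ?add0r.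
Qed.

Lemma mem_1_addv_line (u x : A) :
  reflect (exists p q, x = p%:A + q *: u) (x \in (1 + <[u]>)%VS).
Proof.
apply: (iffP memv_addP) => [[_ /vlineP[p ->] [_ /vlineP[q ->] ->]]|[p [q ->]]].
  by exists p, q.
by exists p%:A; rewrite ?memvZ ?memv_line //; exists (q *: u); rewrite ?memvZ ?memv_line.
Qed.

Lemma central_simple_sub1 (Q : {aspace A}) : central_simple_sub Q -> 1 \in Q.
Proof.
by case=> ZQ _; apply: (subvP (centerv_sub Q)); rewrite ZQ memv_line.
Qed.

(** For nonzero [e] the ideal [Q e Q] contains 1, yet [e] annihilates it from the left. *)
Lemma central_simple_sub_semiprime (Q : {aspace A}) e :
  central_simple_sub Q -> e \in Q -> {in Q, forall x, e * x * e = 0} -> e = 0.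
Proof.
move=> csQ Qe eQe; apply/eqP; apply: contraT => nz_e.
have Q1 := central_simple_sub1 csQ.
pose I := (Q * (<[e]> * Q))%VS.
have sIQ : (I <= Q)%VS by rewrite !prodv_sub ?subvv // -memvE.
have lI : (Q * I <= I)%VS by rewrite /I prodvA prodvSl // asubv.
have rI : (I * Q <= I)%VS by rewrite /I -!prodvA !prodvSr // asubv.
have Ie : e \in I.
  rewrite -[e]mul1r; apply: memv_mul => //.
  by rewrite -{1}[e]mulr1; apply: memv_mul; rewrite ?memv_line.
have [_ /(_ I sIQ lI rI)[I0|IQ]] := csQ.
  by move: nz_e; rewrite -memv0 -I0 Ie.
have: e * 1 = 0; last by move/eqP; rewrite mulr1 (negPf nz_e).
have: 1 \in I by rewrite IQ.
apply: (@prodv_ind _ _ _ _ (fun x => e * x = 0)) 1.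
- exact: mulr0.
- by move=> x y ex ey; rewrite mulrDr ex ey addr0.
move=> a y Qa; move: y.
apply: (@prodv_ind _ _ _ _ (fun y => e * (a * y) = 0)).
- by rewrite !mulr0.
- by move=> x y ex ey; rewrite !mulrDr ex ey addr0.
move=> _ b /vlineP[k ->] Qb.
by rewrite -scalerAl -!scalerAr !mulrA eQe // mul0r scaler0.
Qed.

(** The kernel [C] and the image [D] have dimensions adding up to 4, and [C] contains both [S] and,
    [u * u] being scalar, [D]. Dimension 4 for [C] would make [u] central, and dimension 3 would
    give a nonzero [e] with [e Q e = 0]; so 2 remains. *)
Lemma quaternion_centraliser (Q : {aspace A}) u alpha :
    quaternion_sub Q -> u \in Q -> u \notin 1%VS -> u * u = alpha%:A ->
  (adv u @: Q = 1 + <[u]> /\ Q :&: lker (adv u) = 1 + <[u]>)%VS.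
Proof.
move=> [csQ dimQ] Qu u_nscal uu; have Q1 := central_simple_sub1 csQ.
set C := (Q :&: lker _)%VS; set D := (adv u @: Q)%VS; set S := (1 + <[u]>)%VS.
have memC x : (x \in C) = (x \in Q) && (u * x == x * u).
  by rewrite memv_cap memv_ker advE addr_eq0 opp_char2.
have dimS : \dim S = 2%N.
  rewrite dimv_disjoint_sum ?dimv1 ?dim_vline.
    by case: eqVneq u_nscal => // ->; rewrite mem0v.
  apply/eqP; rewrite -subv0; apply/subvP=> x /memv_capP[x1 /vlineP[k xE]].
  rewrite memv0; move: x1; rewrite {}xE => ku1.
  have [->|nz_k] := eqVneq k 0; first by rewrite scale0r.
  case/negP: u_nscal; rewrite -[u]scale1r -(mulVf nz_k) -scalerA.
  exact: memvZ.
have sSC : (S <= C)%VS.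
  rewrite subv_add -!memvE !memC Qu Q1 mul1r mulr1 !eqxx //.
have sDC : (D <= C)%VS.
  apply/subvP=> _ /memv_imgP[x Qx ->]; rewrite memC advE memvD ?memvM //=.
  rewrite mulrDr mulrDl -!mulrA uu !mulrA uu -scalerAl -scalerAr mul1r mulr1.
  by rewrite addrC.
have dimCD : (\dim C + \dim D = 4)%N by rewrite -dimQ -(limg_ker_dim (adv u) Q).
have dimC2 : (2 <= \dim C)%N by rewrite -dimS dimvS.
have dimC4 : (\dim C != 4)%N.
  apply/eqP=> dimC4; have CQ : C = Q.
    by apply/eqP; rewrite eqEdim capvSl dimC4 dimQ.
  case/negP: u_nscal; rewrite -csQ.1; apply/memv_capP; split=> //.
  by apply/centvP=> x Qx; apply/eqP; move: Qx; rewrite -CQ memC => /andP[].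
have dimC3 : (\dim C != 3)%N.
  apply/eqP=> dimC3; have dimD1 : \dim D = 1%N by lia.
  pose d := vpick D; have Dd : d \in D by apply: memv_pick.
  have nz_d : d != 0 by rewrite vpick0 -dimv_eq0 dimD1.
  have defD : D = <[d]>%VS.
    apply/esym/eqP; rewrite eqEdim -memvE Dd dim_vline nz_d dimD1 //.
  have [l ud] : exists l, u * d = l *: d.
    apply/vlineP; rewrite -defD; case/memv_imgP: Dd => x Qx ->.
    apply/memv_imgP; exists (u * x); first exact: memvM.
    by rewrite !advE mulrDr !mulrA.
  (* [e] has the same commutators as [u], all multiples of [d], and it kills [d]. Together with
     [e * e = 0] this gives [e * x * e = 0]. *)
  pose e := u + l%:A.
  have ed : e * d = 0 by rewrite mulrDl ud -scalerAl mul1r addvv_char2.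
  have ee : e * e = 0.
    have all : alpha = l * l.
      have : (alpha - l * l) *: d = 0.
        rewrite scalerBl -scalerA -ud scalerAr -ud mulrA uu -scalerAl mul1r.
        by rewrite subrr.
      by move/eqP; rewrite scaler_eq0 (negPf nz_d) orbF subr_eq0 => /eqP.
    rewrite mulrDl !mulrDr uu all -!scalerAr -!scalerAl !mul1r !mulr1 scalerA.
    by rewrite [X in _ + X]addrC addvv_char2.
  have Qe : e \in Q by rewrite memvD ?memvZ.
  have e0 : e = 0.
    apply: central_simple_sub_semiprime csQ Qe _ => x Qx.
    have : adv u x \in D by apply: memv_img.
    rewrite defD => /vlineP[k ukd].
    have : e * (e * x + x * e) = 0.
      have -> : e * x + x * e = adv u x.
        rewrite advE mulrDl mulrDr addrACA -scalerAl -scalerAr mul1r mulr1.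
        by rewrite addvv_char2 // addr0.
      by rewrite ukd -scalerAr ed scaler0.
    by rewrite mulrDr mulrA ee mul0r add0r mulrA.
  case/negP: u_nscal; apply/vlineP; exists l.
  by apply/eqP; rewrite -[X in _ == X](opp_char2 char2) -addr_eq0 -/e e0.
have dimC : \dim C = 2%N by lia.
have CS : C = S by apply/esym/eqP; rewrite eqEdim sSC dimC dimS.
split=> //; rewrite -CS; apply/eqP; rewrite eqEdim sDC dimC; lia.
Qed.

Variable s : A -> A.
Hypothesis sI : is_involution s.
Hypothesis orth : ~ Alt s 1.

HB.instance Definition _ := GRing.isLinear.Build F A A *:%R s (inv_lin sI).

Lemma alt_scalar (k : F) : Alt s k%:A -> k = 0.
Proof.
move=> /(altvP sI) alt_k; apply/eqP; apply: contraT => nz_k; case: orth.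
by apply/(altvP sI); rewrite -[1]scale1r -(mulVf nz_k) -scalerA memvZ.
Qed.

Lemma alt_sym u : Alt s u -> s u = u.
Proof. by case=> x ->; rewrite linearB /= (invK sI) -[LHS](opp_char2 char2) opprB. Qed.

(** As [u] lies in the image of [adv u], some [x] has commutator [u]. Both [x * x + x] and [s x - x]
    then commute with [u], hence lie in [F + F u], and their unwanted coordinates are shown to
    vanish. *)
Lemma quaternion_artin_schreier (Q : {aspace A}) u alpha :
    quaternion_sub Q -> {in Q, forall x, s x \in Q} ->
    Alt_in Q s u -> alpha != 0 -> u * u = alpha%:A ->
  exists w, [/\ w \in Q, u * w + w * u = u, s w = w &
    exists a, w * w = w + a%:A].
Proof.
move=> qQ sQ [y Qy uE] nz_alpha uu.
have Qu : u \in Q by rewrite uE memvB ?sQ.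
have alt_u : Alt s u by exists y.
have su := alt_sym alt_u.
have nz_u : u != 0.
  apply: contraNneq nz_alpha => u0; move/esym/eqP: uu.
  by rewrite u0 mul0r scaler_eq0 oner_eq0 orbF.
have u_nscal : u \notin 1%VS.
  apply: contra nz_u => /vlineP[k uk]; move: alt_u; rewrite uk => /alt_scalar->.
  by rewrite scale0r.
have [imD kerD] := quaternion_centraliser qQ Qu u_nscal uu.
have centQ z : z \in Q -> u * z + z * u = 0 -> exists p q, z = p%:A + q *: u.
  move=> Qz uz; apply/mem_1_addv_line; rewrite -kerD; apply/memv_capP; split=> //.
  by rewrite memv_ker advE uz.
have : u \in (adv u @: Q)%VS.
  by rewrite imD; apply/mem_1_addv_line; exists 0, 1; rewrite scale0r add0r scale1r.
case/memv_imgP=> x Qx /esym; rewrite advE => uxu.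
have scal_nu k : k *: u = 0 -> k = 0.
  by move/eqP; rewrite scaler_eq0 (negPf nz_u) orbF => /eqP.
have [a xx] : exists a, x * x = x + a%:A.
  have [|a [b xxE]] := centQ (x * x + x) (memvD (memvM Qx Qx) Qx).
    by rewrite mulrDr mulrDl addrACA uxu commutator_square ?addvv_char2.
  (* [x] commutes with [x * x + x] but not with [u]. *)
  have b0 : b = 0.
    apply: scal_nu; have: x * (x * x + x) = (x * x + x) * x.
      by rewrite mulrDl mulrDr mulrA.
    rewrite xxE mulrDr mulrDl -!scalerAl -!scalerAr mulr1 mul1r => /addrI cxu.
    by rewrite -uxu scalerDr cxu addvv_char2.
  exists a; apply: (addIr x); rewrite xxE b0 scale0r addr0 addrAC.
  by rewrite addvv_char2 // add0r.
have ssx : u * s x + s x * u = u.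
  by rewrite -{1 2}su -!(invM sI) -linearD /= addrC uxu.
have sxx : s x * s x = s x + a%:A.
  by rewrite -(invM sI) xx linearD linearZ /= (inv1 sI).
have [p [q xsx]] : exists p q, s x - x = p%:A + q *: u.
  apply: centQ; first by rewrite memvB ?sQ.
  by rewrite mulrBr mulrBl addrACA -opprD ssx uxu subrr.
(* [p%:A] is a difference of alternating elements. *)
have p0 : p = 0.
  apply: alt_scalar; apply/(altvP sI).
  rewrite -[p%:A](addrK (q *: u)) -xsx memvB ?memvZ //; apply/(altvP sI) => //.
  by exists x.
have sxE : s x = x + q *: u.
  by rewrite -[s x](subrK x) xsx p0 scale0r add0r addrC.
(* [s x] satisfies the same quadratic equation as [x]; substituting [x + q *: u] leaves
   [q * q * alpha = 0]. *)
have q0 : q = 0.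
  have sqE : (x + q *: u) * (x + q *: u) = x * x + q *: u + (q * q * alpha)%:A.
    rewrite mulrDl !mulrDr -!scalerAl -!scalerAr uu !scalerA addrA.
    by rewrite -(addrA (x * x)) -scalerDr [x * u + _]addrC uxu.
  move: sxx; rewrite sxE sqE xx (addrAC x) => /(canRL (addKr _)); rewrite addNr.
  move/eqP; rewrite scaler_eq0 oner_eq0 orbF !mulf_eq0 (negPf nz_alpha) orbF.
  by rewrite orbb => /eqP.
exists x; split=> //; last by exists a.
by rewrite sxE q0 scale0r addr0.
Qed.

End Quaternion.

(** * The algebras generated by the [w_i^2] and by the [u_i]; the Pfister form *)

Section Decomposition.
Set Implicit Arguments. Unset Strict Implicit.
Variables (F : fieldType) (A : falgType F) (s : A -> A).
Hypothesis char2 : 2%N \in [pchar F].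
Hypothesis sI : is_involution s.
Hypothesis orth : ~ Alt s 1.
Variables (n : nat) (u w : 'I_n -> A) (alpha : 'I_n -> F).
Hypothesis nz_alpha : forall i, alpha i != 0.
Hypothesis uu : forall i, u i * u i = (alpha i)%:A.
Hypothesis su : forall i, s (u i) = u i.
Hypothesis sw : forall i, s (w i) = w i.
Hypothesis uw : forall i, u i * w i + w i * u i = u i.
Hypothesis cuu : forall i j, i != j -> u i * u j = u j * u i.
Hypothesis cuw : forall i j, i != j -> u i * w j = w j * u i.
Hypothesis cww : forall i j, i != j -> w i * w j = w j * w i.
Implicit Types (l : seq 'I_n) (I : {set 'I_n}).

HB.instance Definition _ := GRing.isLinear.Build F A A *:%R s (inv_lin sI).

Let w2 i := w i * w i.

Lemma notin_neq (i : 'I_n) l : i \notin l -> {in l, forall j, i != j}.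
Proof. by move=> il j lj; apply: contraNneq il => ->. Qed.

Lemma u_mul_eq0 i q : u i * q = 0 -> q = 0.
Proof.
move=> uq0; have: alpha i *: q = 0.
  by rewrite -[q]mul1r scalerAl -uu -mulrA uq0 mulr0.
by move/eqP; rewrite scaler_eq0 (negPf (nz_alpha i)) => /eqP.
Qed.

Lemma u_w2_u i : u i * w2 i * u i = alpha i *: (w2 i + 1).
Proof.
have -> : u i * w2 i = w2 i * u i + u i.
  by rewrite -{3}(commutator_square char2 (uw i)) addrCA addvv_char2 ?addr0.
by rewrite mulrDl -mulrA uu scalerDr -scalerAr mulr1.
Qed.

Lemma alt_conj v z : s v = v -> Alt s z -> Alt s (v * z * v).
Proof.
move=> sv [x ->]; exists (v * x * v).
by rewrite !(invM sI) sv mulrBr mulrBl mulrA.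
Qed.

(** Conjugation by [u i] preserves [Alt], fixes [p] and [q], and sends [w2 i] to [w2 i + 1]. Adding
    the conjugate to [p + w2 i * q] therefore leaves [q], which must be alternating. *)
Lemma w2_alt_direct i l : i \notin l ->
    {in qspan (map w2 l), forall t, Alt s t -> t = 0} ->
  {in qspan (map w2 l) &, forall p q, Alt s (p + w2 i * q) -> p = 0 /\ q = 0}.
Proof.
move=> il IH p q Bp Bq alt_pq.
have cB : {in qspan (map w2 l), forall y, y * u i = u i * y}.
  apply: cent_qspan => _ /mapP[j lj ->]; have nij := notin_neq il lj.
  by rewrite /w2 mulrA (cuw nij) -!mulrA (cuw nij).
have q0 : q = 0.
  apply: (IH q Bq); apply/(altvP sI).
  have -> : q = (alpha i)^-1 *: (u i * (p + w2 i * q) * u i) + (p + w2 i * q).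
    have -> : u i * (p + w2 i * q) * u i = alpha i *: (p + (w2 i + 1) * q).
      rewrite mulrDr mulrDl -(cB p Bp) -mulrA uu mulrA -(mulrA (u i * _)) (cB q Bq).
      by rewrite mulrA u_w2_u -scalerAr mulr1 -scalerAl -scalerDr.
    rewrite scalerA mulVf // scale1r mulrDl mul1r (addrA p) [RHS]addrAC addvv_char2 //.
    by rewrite add0r.
  apply: memvD; last exact/(altvP sI).
  by rewrite memvZ //; apply/(altvP sI)/alt_conj.
by split=> //; apply: IH Bp _; move: alt_pq; rewrite q0 mulr0 addr0.
Qed.

Lemma w2_alt l : uniq l -> {in qspan (map w2 l), forall t, Alt s t -> t = 0}.
Proof.
elim: l => [_ t|i l IH /= /andP[il ul]].
  by rewrite /qspan big_nil => /vlineP[k ->] /(alt_scalar sI orth)->; rewrite scale0r.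
move=> _ /mem_qspan_cons[p [q [Bp Bq ->]]].
case/(w2_alt_direct il (IH ul) Bp Bq) => -> ->.
by rewrite mulr0 addr0.
Qed.

Lemma alt0 : Alt s 0.
Proof. by apply/(altvP sI); rewrite mem0v. Qed.

Lemma dim_w2 l : uniq l -> \dim (qspan (map w2 l)) = (2 ^ size l)%N.
Proof.
elim: l => [_|i l IH /= /andP[il ul]]; first by rewrite /qspan big_nil dimv1.
rewrite dim_qspan_cons ?IH ?expnS // => p q Bp Bq pq0.
by apply: (w2_alt_direct il (w2_alt ul)); rewrite // pq0; apply: alt0.
Qed.

Lemma qspan_sym (vs : seq A) : {in vs &, commutative *%R} ->
  {in vs, forall v, s v = v} -> {in qspan vs, forall x, s x = x}.
Proof.
elim: vs => [|v vs IH] cvs svs.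
  by rewrite /qspan big_nil => x /vlineP[k ->]; rewrite linearZ /= (inv1 sI).
have cvs' := sub_in2 (@mem_behead _ (v :: vs)) cvs.
have svs' := sub_in1 (@mem_behead _ (v :: vs)) svs.
move=> _ /mem_qspan_cons[p [q [Bp Bq ->]]].
rewrite linearD /= (invM sI) (IH cvs' svs' p Bp) (IH cvs' svs' q Bq) svs ?mem_head //.
congr (_ + _); apply: cent_qspan Bq => x vsx.
by apply: cvs; rewrite inE ?vsx ?eqxx ?orbT.
Qed.

Lemma w_comm l : {in map w l &, commutative *%R}.
Proof.
move=> _ _ /mapP[i _ ->] /mapP[j _ ->].
by have [->|] := eqVneq i j; last exact: cww.
Qed.

(** For [y] generated by the other [w j], symmetric and commuting with [w i], the product
    [w2 i * (s y * y)] is again of the form [s y' * y'], with [y' = w i * y]. *)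
Lemma w2_sub_squares l (V : {vspace A}) :
  (forall y, y \in qspan (map w l) -> s y * y \in V) -> (qspan (map w2 l) <= V)%VS.
Proof.
elim: l V => [|i l IH] V sqV.
  rewrite /qspan big_nil -memvE -[1]mulr1 -{1}(inv1 sI); apply: sqV.
  by rewrite /qspan big_nil memv_line.
apply/subvP=> _ /mem_qspan_cons[p [q [Bp Bq ->]]]; apply: memvD.
  apply: (subvP (IH V _)) p Bp => y By.
  by apply: sqV; apply: (subvP (sub_qspan_cons _ _)).
(* The induction hypothesis is applied to the preimage of [V] under multiplication by [w2 i]. *)
have <- : amull (w2 i) q = w2 i * q by rewrite lfunE.
rewrite memv_preim; apply: (subvP (IH _ _)) q Bq => y By.
rewrite -memv_preim lfunE /= /w2.
have sy : s y = y.
  apply: qspan_sym By; first exact: w_comm.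
  by move=> _ /mapP[j _ ->].
have yw : y * w i = w i * y.
  apply: cent_qspan By => x lx; apply: (@w_comm (i :: l)).
    by rewrite /= inE lx orbT.
  by rewrite /= mem_head.
have -> : w i * w i * (s y * y) = s (w i * y) * (w i * y).
  by rewrite (invM sI) sw sy mulrA yw -!mulrA (mulrA y) yw -!mulrA.
apply: sqV; apply/mem_qspan_cons; exists 0, y.
by rewrite mem0v add0r.
Qed.

Lemma u_comm l : {in map u l &, commutative *%R}.
Proof.
move=> _ _ /mapP[i _ ->] /mapP[j _ ->].
by have [->|] := eqVneq i j; last exact: cuu.
Qed.

Lemma u_scalar l : {in map u l, forall v, v * v \in 1%VS}.
Proof. by move=> _ /mapP[i _ ->]; rewrite uu memvZ ?memv_line. Qed.

(** Commutation with [w i] kills [p] and fixes [u i * q], so a relation [p + u i * q = 0] forces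
    [u i * q = 0], and [u i] is invertible. *)
Lemma dim_u l : uniq l -> \dim (qspan (map u l)) = (2 ^ size l)%N.
Proof.
elim: l => [_|i l IH /= /andP[il ul]]; first by rewrite /qspan big_nil dimv1.
rewrite dim_qspan_cons ?IH ?expnS // => p q Bp Bq pq0.
have cB : {in qspan (map u l), forall y, y * w i = w i * y}.
  apply: cent_qspan => _ /mapP[j lj ->]; apply: cuw.
  by rewrite eq_sym (notin_neq il lj).
have q0 : q = 0.
  apply: (@u_mul_eq0 i).
  have : w i * (p + u i * q) + (p + u i * q) * w i = 0.
    by rewrite pq0 mulr0 mul0r addr0.
  rewrite mulrDr mulrDl (cB p Bp) addrACA addvv_char2 // add0r.
  by rewrite -mulrA (cB q Bq) !mulrA -mulrDl addrC uw.
by split=> //; move: pq0; rewrite q0 mulr0 addr0.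
Qed.

(** The monomials are indexed by subsets to match the diagonal Pfister form, whose entries are their
    squares. *)
Definition umon l I : A := \prod_(i <- l) (if i \in I then u i else 1).

Lemma umon_cons i l I :
  umon (i :: l) I = (if i \in I then u i else 1) * umon l I.
Proof. by rewrite /umon big_cons. Qed.

Lemma mem_umon l I : umon l I \in qspan (map u l).
Proof.
elim: l => [|i l IH]; first by rewrite /umon /qspan !big_nil memv_line.
rewrite umon_cons; case: ifP => _; last first.
  by rewrite mul1r (subvP (sub_qspan_cons _ _)).
by apply/mem_qspan_cons; exists 0, (umon l I); rewrite mem0v add0r.
Qed.

Lemma umon_sq l I :
  umon l I * umon l I = (\prod_(i <- l | i \in I) alpha i)%:A.
Proof.
elim: l => [|i l IH]; first by rewrite /umon !big_nil mulr1 scale1r.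
rewrite umon_cons big_cons; case: ifP => _; last by rewrite mul1r.
have c : umon l I * u i = u i * umon l I.
  apply: cent_qspan (mem_umon l I) => x lx; apply: (@u_comm (i :: l)).
    by rewrite /= inE lx orbT.
  by rewrite /= mem_head.
by rewrite mulrA -(mulrA _ _ (u i)) c !mulrA uu -!scalerAl mul1r IH scalerA.
Qed.

Lemma eq_umon l (I J : {set 'I_n}) : {in l, I =i J} -> umon l I = umon l J.
Proof.
by move=> eqIJ; rewrite /umon !(big_seq _ _ l); apply: eq_bigr => i /eqIJ->.
Qed.

Lemma qspan_umon l : uniq l ->
  (qspan (map u l) <= <<[seq umon l J | J : {set 'I_n}]>>)%VS.
Proof.
elim: l => [_|i l IH /= /andP[il ul]].
  rewrite /qspan big_nil -memvE; apply: memv_span.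
  by apply/imageP; exists set0; rewrite // /umon big_nil.
apply/subvP=> _ /mem_qspan_cons[p [q [Bp Bq ->]]]; apply: memvD.
  apply: (subvP _ p (subvP (IH ul) _ Bp)).
  apply/span_subvP=> _ /imageP[I _ ->]; apply: memv_span.
  (* As [i] is not in [l], its membership in the index set only decides the head factor: it is
     removed here and added below. *)
  apply/imageP; exists (I :\ i) => //.
  rewrite umon_cons !inE eqxx mul1r; apply: eq_umon => j lj.
  by rewrite !inE eq_sym (notin_neq il lj).
have <- : amull (u i) q = u i * q by rewrite lfunE.
rewrite memv_preim; apply: (subvP _ q (subvP (IH ul) _ Bq)).
apply/span_subvP=> _ /imageP[I _ ->]; rewrite -memv_preim lfunE /=.
apply: memv_span; apply/imageP; exists (i |: I) => //.
rewrite umon_cons !inE eqxx; congr (_ * _); apply: eq_umon => j lj.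
by rewrite !inE eq_sym (negPf (notin_neq il lj)).
Qed.

(** Squaring is additive, so the square of the combination of monomials with coefficients [v] is the
    Pfister form at [v]. The monomials form a basis, so nonzero vectors correspond to nonzero
    elements. *)
Lemma pfister_representsP (c : F) (l := enum 'I_n) :
  pfister_represents alpha c <->
    exists2 x, x \in qspan (map u l) /\ x != 0 & x * x = c%:A.
Proof.
pose S := qspan (map u l).
have sqE (v : {set 'I_n} -> F) : let x := \sum_(I : {set 'I_n}) v I *: umon l I in
    x \in S /\ x * x = (\sum_(I : {set 'I_n}) (\prod_(i in I) alpha i) * v I ^+ 2)%:A.
  apply: (big_ind2 (fun x k => x \in S /\ x * x = k%:A)).
  - by rewrite mem0v mulr0 scale0r.
  - move=> x k y m [Sx xx] [Sy yy]; split; first by rewrite memvD.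
    rewrite mulrDl !mulrDr xx yy (qspan_comm (@u_comm l) Sy Sx) addrACA.
    by rewrite addrA -(addrA k%:A) addvv_char2 // addr0 scalerDl.
  move=> I _; rewrite memvZ ?mem_umon //; split=> //.
  rewrite -scalerAl -scalerAr umon_sq !scalerA; congr (_ *: 1).
  by rewrite mulrC big_enum_cond.
pose T := {set 'I_n}.
pose tup := [tuple umon l (enum_val i : T) | i < #|{: T}|].
have tupE (k : 'I_#|{: T}| -> F) :
    \sum_i k i *: tup`_i = \sum_(I : {set 'I_n}) k (enum_rank I) *: umon l I.
  rewrite (reindex (@enum_val T predT)); last exact/onW_bij/enum_val_bij.
  by apply: eq_bigr => i _; rewrite enum_valK nth_mktuple.
have S_tup : (S <= <<tup>>)%VS.
  apply: subv_trans (qspan_umon (enum_uniq _)) _; apply: sub_span => _ /imageP[I _ ->].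
  by apply/tnthP; exists (enum_rank I); rewrite tnth_mktuple enum_rankK.
(* There are [2 ^ n] monomials, and they span a space of at least that dimension. *)
have tup_free : free tup.
  rewrite /free eqn_leq dim_span size_tuple; apply: leq_trans (dimvS S_tup).
  by rewrite dim_u ?enum_uniq // -cardE card_ord -cardsT -powersetT card_powerset cardsT card_ord.
split=> [[v nz_v ->]|[x [Sx nz_x] xx]].
  have [Sx xx] := sqE v; exists (\sum_(I : {set 'I_n}) v I *: umon l I) => //; split=> //.
  apply: contra nz_v => /eqP v0; apply/eqP/ffunP=> I; rewrite ffunE.
  rewrite -[I]enum_rankK; move: (enum_rank I); move/freeP: tup_free; apply.
  by rewrite tupE -[RHS]v0; apply: eq_bigr => J _; rewrite enum_rankK.
pose v := [ffun I : T => coord tup (enum_rank I) x].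
have xE : x = \sum_(I : {set 'I_n}) v I *: umon l I.
  rewrite [LHS](coord_span (subvP S_tup x Sx)) tupE.
  by apply: eq_bigr => I _; rewrite ffunE.
exists v.
  by apply: contra nz_x => /eqP v0; rewrite xE big1 // => I _; rewrite v0 ffunE scale0r.
have := (sqE v).2; rewrite -xE xx => /eqP; rewrite -subr_eq0 -scalerBl scaler_eq0.
by rewrite oner_eq0 orbF subr_eq0 => /eqP.
Qed.

End Decomposition.

(** * Both descriptions of the represented scalars *)

Theorem theorem4p10 (F : fieldType) (A : falgType F) (s : A -> A)
    (n : nat) (Q : 'I_n -> {aspace A}) (alpha : 'I_n -> F) :
  2%N \in [pchar F] ->
  central_simple A ->
  is_involution s ->
  orth_involution s ->
  tot_decomposition s Q ->
  (forall i, represents_disc (Q i) s (alpha i)) ->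
  (forall c : F, represents s c <-> pfister_represents alpha c) /\
  (forall S : {aspace A}, inseparable_sub s n S ->
     forall c : F, represents s c <->
       exists2 x : A, x \in S /\ x != 0 & x * x = c%:A).
Proof.
move=> char2 csA sI orth [qQ sQ cQ _ dimA] disc.
have nz_alpha i : alpha i != 0 by case: (disc i).
have exu i : exists x, Alt_in (Q i) s x /\ x * x = (alpha i)%:A.
  by have [_ [x [alt_x _] xx]] := disc i; exists x.
have [u uP] := fin_all_exists exu.
have uu i := (uP i).2.
have [w wP] := fin_all_exists (fun i => quaternion_artin_schreier char2 sI orth
  (qQ i) (sQ i) (uP i).1 (nz_alpha i) (uu i)).
have su i : s (u i) = u i.
  by apply: (alt_sym char2 sI); have [[y _ ->] _] := uP i; exists y.
have Qu i : u i \in Q i.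
  by have [[y Qy ->] _] := uP i; rewrite memvB ?sQ.
have Qw i : w i \in Q i by have [] := wP i.
have uw i : u i * w i + w i * u i = u i by have [] := wP i.
have sw i : s (w i) = w i by have [] := wP i.
have cQQ i j x y : i != j -> x \in Q i -> y \in Q j -> x * y = y * x.
  by move=> nij Qx Qy; have /centvsP := cQ i j nij; apply.
have cuu i j : i != j -> u i * u j = u j * u i by move/cQQ; apply.
have cuw i j : i != j -> u i * w j = w j * u i by move/cQQ; apply.
have cww i j : i != j -> w i * w j = w j * w i by move/cQQ; apply.
pose l := enum 'I_n; have ul : uniq l := enum_uniq _.
have size_l : size l = n by rewrite -cardE card_ord.
(* This serves both equalities, with [vs] the [u i] or the generators of [S]. The test space [T] is
   the span of the products of the [w_i^2] in either case. *)
have represented (vs : seq A) : size vs = n ->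
    {in vs &, commutative *%R} -> {in vs, forall v, v * v \in 1%VS} ->
    {in qspan vs, forall x, s x = x} -> \dim (qspan vs) = (2 ^ n)%N ->
  forall c, represents s c <->
    exists2 x, x \in qspan vs /\ x != 0 & x * x = c%:A.
  move=> size_vs cvs sqvs symvs dimvs c; split=> [rep_c|[x [Sx nz_x] xx]].
    apply: (represented_square char2 csA sI cvs sqvs symvs) rep_c => //.
    - by rewrite size_vs.
    - by rewrite size_vs.
    - exact: (w2_alt char2 sI orth nz_alpha uu su uw cuw ul).
    - by rewrite (dim_w2 char2 sI orth nz_alpha uu su uw cuw ul) size_l size_vs.
    move=> V sqV; apply: (w2_sub_squares sI sw cww) => y _; exact: sqV.
  (* For symmetric [x] with square [c], [s x * x + c%:A] is twice [c%:A], that is, [0 = s 0 - 0]. *)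
  exists x => //; exists 0; rewrite symvs // xx addvv_char2 // subr0.
  by case: sI => lin_s _ _ _; have := lin_s (-1) 0 0; rewrite scaler0 addr0 scaleN1r addNr.
split=> [c|S [dimS symS _ [gens genS]] c].
  rewrite (pfister_representsP char2 nz_alpha uu uw cuu cuw).
  apply: represented.
  - by rewrite size_map.
  - exact: (@u_comm F A n u cuu l).
  - exact: (@u_scalar F A n u alpha uu l).
  - apply: (qspan_sym sI); first exact: (@u_comm F A n u cuu l).
    by move=> _ /mapP[i _ ->].
  by rewrite (dim_u char2 nz_alpha uu uw cuw ul) size_l.
have Sgens : {subset gens <= S}.
  by move=> g gg; rewrite genS; apply: (subvP (sub_agenv _)); apply: memv_span.
(* A product of two elements of [S] is itself symmetric, and [s] reverses it. *)
have cS : {in S &, commutative *%R}.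
  move=> x y Sx Sy; have [sxy _] := symS _ (memvM Sx Sy).
  by rewrite -sxy (invM sI) (symS x Sx).1 (symS y Sy).1.
have cgens : {in gens &, commutative *%R} := sub_in2 Sgens cS.
have sqgens : {in gens, forall v, v * v \in 1%VS}.
  by move=> v /Sgens/symS[_ [k ->]]; rewrite memvZ ?memv_line.
(* [qspan gens] is closed under multiplication by the generators, so it contains [S]; its dimension
   is at most [2 ^ n]. *)
have S_qspan : (S : {vspace A}) = qspan gens.
  apply/eqP; rewrite eqEdim dimS; apply/andP; split.
    rewrite genS; apply: agenv_sub_modl; first by rewrite -memvE qspan1.
    apply/prodvP=> x y gx gy; apply: (qspanM cgens sqgens) gy.
    by apply: subvP x gx; apply/span_subvP => g; apply: mem_qspan.
  by apply: leq_trans (dim_qspan_leq _) _; rewrite size_tuple.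
rewrite (represented gens) ?size_tuple // -?S_qspan //.
by move=> x Sx; have [] := symS x Sx.
Qed.
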